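(* Let $(\mathcal{X},Y)$ and $(\mathcal{X}',Y')$ be finite regular CW pairs. Suppose there is a poset isomorphism $\varphi:\mathcal{X}\to\mathcal{X}'$ of cell posets with $\varphi(\mathcal{X}_Y)=\mathcal{X}'_{Y'}$. Then there exists a homeomorphism $\Phi:|\mathcal{X}|\to|\mathcal{X}'|$ mapping each cell $\sigma$ onto $\varphi(\sigma)$ and mapping $Y$ onto $Y'$.
   Context: Cells. Let $X$ be Hausdorff. A subset $\sigma\subset X$ is an $n$-cell if there is a homeomorphism $\alpha:D^n\to\sigma$ from the closed unit ball. Its relative boundary is $d\sigma=\alpha(\partial D^n)$. Regular CW complexes. A finite regular CW complex $\mathcal{X}$ with support $|\mathcal{X}|=X$ is a finite collection of cells in $X$ such that - their relative interiors $\sigma\setminus d\sigma$ partition $X$, and - each relative boundary $d\sigma$ is a union of cells of $\mathcal{X}$ of smaller dimension. The cell poset is $\mathcal{X}$ ordered by inclusion. Standard pairs. A pair $\tau\subset\sigma$ is a standard pair of cells of codimension $k$ if some homeomorphism $\alpha:D^n\to\sigma$ has $\alpha^{-1}(\tau)=\{x\in D^n:x_1=\dots=x_k=0\}$. Regular CW pairs. A finite regular CW pair of codimension $k$ is $(\mathcal{X},Y)$ with $\mathcal{X}$ a finite regular CW complex and $Y\subset|\mathcal{X}|$ such that for every $\sigma\in\mathcal{X}$ either $\sigma\cap Y=\emptyset$ or $\sigma\cap Y\subset\sigma$ is a standard pair of cells of codimension $k$. Write $\mathcal{X}_Y=\{\sigma\in\mathcal{X}:\sigma\cap Y\ne\emptyset\}$.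 *)

(* Defs.v *)
From HB Require Import structures.
From mathcomp Require Import all_boot all_order all_algebra.
From mathcomp Require Import all_classical all_reals all_analysis.
Import numFieldNormedType.Exports.
Set Implicit Arguments. Unset Strict Implicit. Unset Printing Implicit Defensive.
Import Order.TTheory GRing.Theory Num.Theory.
Local Open Scope classical_set_scope.
Local Open Scope ring_scope.

Definition unit_ball (R : realType) (n : nat) : set 'rV[R]_n :=
  [set x | \sum_(i < n) x ord0 i ^+ 2 <= 1].
Definition unit_sphere (R : realType) (n : nat) : set 'rV[R]_n :=
  [set x | \sum_(i < n) x ord0 i ^+ 2 = 1].
Arguments unit_ball R n : clear implicits.
Arguments unit_sphere R n : clear implicits.

Definition homeo_on (T U : topologicalType) (A : set T) (B : set U) (f : T -> U) :=
  exists g : U -> T,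
    [/\ {within A, continuous f}, {within B, continuous g}, f @` A = B,
        (forall x, A x -> g (f x) = x) & (forall y, B y -> f (g y) = y)].

Definition is_cell (R : realType) (X : topologicalType) (n : nat) (sigma : set X) :=
  exists alpha : 'rV[R]_n -> X, homeo_on (unit_ball R n) sigma alpha.

(* relative boundary d sigma = alpha(boundary of D^n) for a characteristic map alpha
   (independent of alpha by invariance of domain). *)
Definition relbd (R : realType) (X : topologicalType) (sigma : set X) : set X :=
  [set x | exists n (alpha : 'rV[R]_n -> X),
     homeo_on (unit_ball R n) sigma alpha /\ (alpha @` unit_sphere R n) x].

Definition relint (R : realType) (X : topologicalType) (sigma : set X) : set X :=
  sigma `\` relbd R sigma.

Definition regular_CW (R : realType) (X : topologicalType) (I : finType)
    (c : I -> set X) :=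
  [/\ injective c,
      (forall x : X, exists! i, relint R (c i) x) &
      (forall i, exists n, is_cell R n (c i) /\
         exists J : set I, relbd R (c i) = \bigcup_(j in J) c j /\
           (forall j, J j -> exists2 m, (m < n)%N & is_cell R m (c j)))].

Definition standard_pair (R : realType) (X : topologicalType) (k : nat)
    (tau sigma : set X) :=
  tau `<=` sigma /\
  exists n (alpha : 'rV[R]_n -> X), (k <= n)%N /\
    homeo_on (unit_ball R n) sigma alpha /\
    (forall x, unit_ball R n x ->
       (tau (alpha x) <-> forall i : 'I_n, (i < k)%N -> x ord0 i = 0)).

Definition regular_CW_pair (R : realType) (X : topologicalType) (I : finType)
    (c : I -> set X) (k : nat) (Y : set X) :=
  regular_CW R c /\
  forall i, c i `&` Y = set0 \/ standard_pair R k (c i `&` Y) (c i).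

Definition cells_meeting (X : Type) (I : Type) (c : I -> set X) (Y : set X) : set I :=
  [set i | c i `&` Y !=set0].

(* Main.v *)
Require Import Defs.
From HB Require Import structures.
From mathcomp Require Import all_boot all_order all_algebra.
From mathcomp Require Import all_classical all_reals all_analysis.
From mathcomp Require Import ring lra.
Import numFieldNormedType.Exports.
Set Implicit Arguments. Unset Strict Implicit. Unset Printing Implicit Defensive.
Import Order.TTheory GRing.Theory Num.Theory.
Local Open Scope classical_set_scope.
Local Open Scope ring_scope.

(** A homeomorphism is built cell by cell: over a minimal new cell it is already
    defined on the relative boundary and extends by Alexander's trick in the two
    characteristic maps.  In charts of standard pairs a cone map respects the
    coordinate subspaces as soon as its restriction to the sphere does, so [Y] goes
    to [Y'] whatever the dimensions of the two cells.

    This requires that the relative boundary does not depend on the chart: a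
    homeomorphism [h] of balls sends no interior point [x0] to the sphere.  Otherwise,
    the complement of [h x0] being star-shaped, the identity of the sphere around
    [x0] would extend to the ball without taking the value [x0], against the
    Poincare-Miranda theorem.  The latter comes by compactness from a discrete
    statement on the torus [(Z/N)^n]: for cubical cochains mod 2 the cup product of
    [n] cocycles, summed over all cubes, depends only on their classes. *)

(** * Cup products on a finite torus *)

Lemma F2_addxx (x : 'F_2) : x + x = 0.
Proof. by rewrite -mulr2n -mulr_natl (_ : 2%:R = 0 :> 'F_2) ?mul0r //; apply/val_inj. Qed.

Lemma oppr_F2 (x : 'F_2) : - x = x.
Proof. by apply/eqP; rewrite eq_sym -addr_eq0 F2_addxx. Qed.

(** Swapping the two indices pairs each term with an equal one, and equal terms cancel mod 2. *)
Lemma sum_symmetric_F2 (J : finType) (Q : J -> J -> bool) (F : J -> J -> 'F_2) :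
  (forall i j, Q i j = Q j i) -> (forall i, ~~ Q i i) ->
  (forall i j, Q i j -> F i j = F j i) ->
  \sum_i \sum_(j | Q i j) F i j = 0.
Proof.
move=> Qsym Qirr Fsym; rewrite pair_big_dep /=.
rewrite (bigID (fun p => (enum_rank p.1 < enum_rank p.2)%N)) /=.
rewrite [X in _ + X](reindex_inj (h := fun p : J * J => (p.2, p.1))) /=; last first.
  by move=> [a b] [c d] [-> ->].
rewrite [X in _ + X](eq_big (fun p : J * J => Q p.1 p.2 && (enum_rank p.1 < enum_rank p.2)%N)
  (fun p => F p.1 p.2)) /=.
- exact: F2_addxx.
- move=> [i j] /=; rewrite Qsym; case Qij: (Q i j) => //=.
  rewrite -leqNgt leq_eqVlt; case: eqP => // /val_inj/enum_rank_inj ij.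
  by move: Qij; rewrite ij (negbTE (Qirr _)).
- by move=> [i j] /= /andP[Qij _]; apply: Fsym.
Qed.

Section Stokes.
Variables (G : finZmodType) (J : finType) (e : J -> G).
Implicit Types (a : G -> J -> 'F_2) (f : G -> 'F_2) (p q : G -> {set J} -> 'F_2).
Implicit Types (s : seq (G -> J -> 'F_2)).

(* [p x A] is the value at the vertex [x] of a path that has already used the
   directions in [A].  Thus [total (steps [:: a_1; ..; a_n] top_cell)] is the sum over
   all cubes and all monotone paths across them of the products of the values of the
   [a_i] on the successive edges, i.e. the cup product of the [a_i] evaluated on the
   fundamental class mod 2; [theta] is the sum of the shifts, its anticommutator with
   a function is the coboundary. *)
Definition step a p x (A : {set J}) : 'F_2 :=
  \sum_(j | j \notin A) a x j * p (x + e j) (j |: A).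
Definition steps s p := foldr step p s.
Definition scale f p x (A : {set J}) := f x * p x A.
Definition csum p q x (A : {set J}) := p x A + q x A.
Definition theta := step (fun _ _ => 1).
Definition coboundary f x j := f x + f (x + e j).
Definition cocycle a := forall x i j, a x i + a (x + e i) j = a x j + a (x + e j) i.
Definition total p := \sum_x p x finset.set0.
Definition top_cell (x : G) (A : {set J}) : 'F_2 := (A == [set: J]%SET)%:R.

Lemma step_sum (T : finType) a (p : T -> G -> {set J} -> 'F_2) :
  step a (fun x A => \sum_t p t x A) = (fun x A => \sum_t step a (p t) x A).
Proof.
apply/funext => x; apply/funext => A; rewrite /step exchange_big /=.
by apply: eq_bigr => j _; rewrite mulr_sumr.
Qed.

Lemma steps_sum (T : finType) s (p : T -> G -> {set J} -> 'F_2) :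
  steps s (fun x A => \sum_t p t x A) = (fun x A => \sum_t steps s (p t) x A).
Proof. by elim: s => [|a s IH] //=; rewrite -step_sum -IH. Qed.

Lemma stepD a p q : step a (csum p q) = csum (step a p) (step a q).
Proof.
apply/funext => x; apply/funext => A; rewrite /csum /step /=.
rewrite -big_split /=.
by apply: eq_bigr => j _; rewrite -mulrDr.
Qed.


Lemma steps_cat s1 s2 p : steps (s1 ++ s2) p = steps s1 (steps s2 p).
Proof. exact: foldr_cat. Qed.

Lemma stepsD s p q : steps s (csum p q) = csum (steps s p) (steps s q).
Proof. by elim: s => [|a s IH] //=; rewrite -stepD -IH. Qed.

Lemma totalD p q : total (csum p q) = total p + total q.
Proof. by rewrite /total -big_split. Qed.

Lemma step_coboundary f p :
  step (coboundary f) p = csum (theta (scale f p)) (scale f (theta p)).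
Proof.
apply/funext => x; apply/funext => A; rewrite /csum /theta /scale /step /=.
rewrite mulr_sumr -big_split; apply: eq_bigr => j _ /=.
by rewrite !mul1r /coboundary mulrDl addrC.
Qed.

Lemma theta_step a p : cocycle a -> step a (theta p) = theta (step a p).
Proof.
move=> ac; apply/funext => x; apply/funext => A; apply/eqP.
rewrite -subr_eq0 oppr_F2; apply/eqP; rewrite /theta /step.
rewrite -big_split big_mkcond /=.
rewrite -[RHS](@sum_symmetric_F2 J (fun i j => [&& i \notin A, j \notin A & i != j])
  (fun i j => (a x i + a (x + e i) j) * p (x + e i + e j) (j |: (i |: A)))%SET); first last.
- move=> i j _; rewrite ac [X in p X _]addrAC; congr (_ * p _ _).
  by rewrite !finset.setUA [([set _] :|: _)%SET]finset.setUC.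
- by move=> i; rewrite eqxx !andbF.
- by move=> i j; rewrite eq_sym andbCA.
apply: eq_bigr => i _; case: ifP => iA; last by rewrite big_pred0.
rewrite mulr_sumr mul1r -big_split /=; apply: eq_big => [j|j jA].
  by rewrite !inE negb_or andbC eq_sym.
by rewrite mul1r mulrDl.
Qed.

Lemma theta_steps s p : (forall a, a \in s -> cocycle a) ->
  steps s (theta p) = theta (steps s p).
Proof.
elim: s => [|a s IH] //= sc; rewrite IH => [|b bs]; last by apply: sc; rewrite inE bs orbT.
by rewrite theta_step //; apply: sc; rewrite inE eqxx.
Qed.

(* [face_of j p q]: [q] is [p] with the direction [j] already used up. *)
Definition face_of j p q :=
  forall x A, q x A = if j \in A then 0 else p x (j |: A)%SET.

Lemma face_of_step j a p q : face_of j p q -> face_of j (step a p) (step a q).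
Proof.
move=> pq x A; rewrite /step; case: ifP => jA.
  by rewrite big1 // => i _; rewrite pq finset.in_setU1 jA orbT mulr0.
rewrite (bigD1 j) ?jA //= pq finset.setU11 mulr0 add0r.
apply: eq_big => [i|i /andP[iA ij]]; first by rewrite finset.in_setU1 negb_or andbC.
rewrite pq finset.in_setU1 eq_sym (negbTE ij) jA /=.
by rewrite !finset.setUA [([set _] :|: _)%SET]finset.setUC.
Qed.

Lemma face_of_steps j s p q : face_of j p q -> face_of j (steps s p) (steps s q).
Proof. by move=> pq; elim: s => //= a s; apply: face_of_step. Qed.

Lemma face_of_scale j f p q : face_of j p q -> face_of j (scale f p) (scale f q).
Proof. by move=> pq x A; rewrite /scale pq; case: ifP; rewrite ?mulr0. Qed.

(** Translation by [e j] permutes the finite group, so summing over all vertices absorbs the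
    shift. *)
Lemma total_theta p : total (theta p) = \sum_j \sum_x p x [set j]%SET.
Proof.
rewrite /total /theta /step exchange_big /=.
under eq_bigl do rewrite finset.in_set0.
apply: eq_bigr => j _; rewrite [RHS](reindex_inj (addIr (e j))) /=.
by apply: eq_bigr => x _; rewrite mul1r finset.setU0.
Qed.

(** Discrete Stokes theorem. By [step_coboundary] one gets two terms with a [theta]: one [theta]
    moves left past [s1] to the outside, the other right past [s2] to [top_cell]. Both then give the
    same sum over the direction [j] removed from the cube, at the start of the path or at its
    end. *)
Lemma total_steps_coboundary s1 f s2 :
  (forall a, a \in s1 -> cocycle a) -> (forall a, a \in s2 -> cocycle a) ->
  total (steps s1 (step (coboundary f) (steps s2 top_cell))) = 0.
Proof.
move=> c1 c2; rewrite step_coboundary stepsD totalD theta_steps // -(theta_steps _ c2).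
set M := fun p => steps s1 (scale f (steps s2 p)).
rewrite -/(M top_cell) -/(M (theta top_cell)).
pose face j (x : G) (A : {set J}) : 'F_2 := (A == ~: [set j])%SET%:R.
(* The last shift, into the full set, supplies the single direction still missing. *)
have -> : theta top_cell = (fun x A => \sum_j face j x A).
  apply/funext => x; apply/funext => A; rewrite /theta /step big_mkcond /=.
  apply: eq_bigr => j _; rewrite /face mul1r /top_cell.
  case: ifP => jA; last by case: eqP => // E; move: jA; rewrite E !inE eqxx.
  congr (nat_of_bool _)%:R.
  apply/eqP/eqP => [E|->].
    apply/setP => i; move/setP/(_ i): E; rewrite !inE.
    by case: eqP => [->|_ /= ->//]; rewrite (negbTE jA).
  by rewrite finset.setUCr.
have -> : M (fun x A => \sum_j face j x A) = (fun x A => \sum_j M (face j) x A).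
  rewrite /M steps_sum -[RHS]steps_sum; congr (steps _ _).
  by apply/funext => x; apply/funext => A; rewrite /scale mulr_sumr.
rewrite total_theta /total [X in _ + X]exchange_big /= -big_split /=.
rewrite big1 // => j _; rewrite -big_split big1 //= => x _.
have MF : face_of j (M top_cell) (M (face j)).
  apply/face_of_steps/face_of_scale/face_of_steps => y A.
  rewrite /face /top_cell; case: ifP => jA.
    by case: eqP => // E; move: jA; rewrite E !inE eqxx.
  congr (nat_of_bool _)%:R.
  apply/eqP/eqP => [->|E]; first by rewrite finset.setUCr.
  apply/setP => i; move/setP/(_ i): E; rewrite !inE.
  by case: eqP => [->|_ /= ->//]; rewrite jA.
by rewrite MF finset.in_set0 finset.setU0 F2_addxx.
Qed.

End Stokes.

Lemma step_form_add (G : finZmodType) (J : finType) (e : J -> G) a b p :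
  step e (fun x j => a x j + b x j) p = csum (step e a p) (step e b p).
Proof.
apply/funext => x; apply/funext => A; rewrite /csum /step -big_split /=.
by apply: eq_bigr => j _; rewrite mulrDl.
Qed.

Lemma cocycle_coboundary (G : finZmodType) (J : finType) (e : J -> G) f :
  cocycle e (coboundary e f).
Proof.
move=> x i j; rewrite /coboundary [x + e i + e j]addrAC.
rewrite -!addrA; congr (_ + _); rewrite !addrA !F2_addxx.
by rewrite !add0r.
Qed.

Lemma cocycleD (G : finZmodType) (J : finType) (e : J -> G) a b :
  cocycle e a -> cocycle e b -> cocycle e (fun x j => a x j + b x j).
Proof. by move=> ca cb x i j; rewrite addrACA ca cb addrACA. Qed.

(* A nonzero value is witnessed by a path in the cube at [x]; each form on the
   list is nonzero on one of its edges. *)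
Lemma steps_neq0 (G : finZmodType) (J : finType) (e : J -> G) s p (x : G) (A : {set J}) :
  steps e s p (x + \sum_(l in A) e l) A != 0 ->
  forall a, a \in s -> exists (B : {set J}) (j : J),
    j \notin B /\ a (x + \sum_(l in B) e l) j != 0.
Proof.
elim: s A => [|b s IH] A //= sn0 a.
have [/existsP[j /andP[jA ne0]]|/existsPn none] :=
    boolP [exists j, (j \notin A) && (b (x + \sum_(l in A) e l) j *
      steps e s p (x + \sum_(l in A) e l + e j) (j |: A)%SET != 0)]; last first.
  move: sn0; rewrite /step big1 ?eqxx // => j jA; apply/eqP.
  by move: (none j); rewrite jA negbK.
rewrite inE => /orP[/eqP->|].
  by exists A, j; split=> //; apply: contraNneq ne0 => ->; rewrite mul0r.
apply: (IH (j |: A)%SET); apply: contraNneq ne0.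
by rewrite big_setU1 //= [e j + _]addrC addrA => ->; rewrite mulr0.
Qed.

(** * Sign changes on a grid *)

Section Grid.
Variables (n N : nat).
Notation G := 'rV['I_N.+2]_n.
Variable s : 'I_n -> G -> bool.
Hypothesis s0 : forall i (v : G), v ord0 i = 0 -> s i v = false.
Hypothesis s1 : forall i (v : G), v ord0 i = ord_max -> s i v = true.

Definition unit_step (j : 'I_n) : G := \row_i (i == j)%:R.
Definition sign_change i := coboundary unit_step (fun x => (s i x)%:R).
(* The class of the [i]-th coordinate circle, carried by the edges from [ord_max] to
   [0]: the function [s i] jumps back on these edges, so [lifted_change i] vanishes
   on every cube that wraps around in direction [i]. *)
Definition wrap (i : 'I_n) (x : G) (j : 'I_n) : 'F_2 := ((j == i) && (x ord0 i == ord_max))%:R.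
Definition lifted_change i x j := sign_change i x j + wrap i x j.

Lemma unit_stepE (x : G) j i : (x + unit_step j) ord0 i = x ord0 i + (i == j)%:R.
Proof. by rewrite !mxE. Qed.

Lemma cocycle_wrap i : cocycle unit_step (wrap i).
Proof.
move=> x a b; rewrite /wrap !unit_stepE.
have [->|ai] := eqVneq a b => //.
have [ai2|ai2] := eqVneq a i; have [bi2|bi2] := eqVneq b i => //=;
  by rewrite ?addr0 ?add0r //; move: ai; rewrite ai2 bi2 eqxx.
Qed.

Lemma cocycle_lifted_change i : cocycle unit_step (lifted_change i).
Proof. exact/cocycleD/cocycle_wrap/cocycle_coboundary. Qed.

(** The factors are exchanged one at a time: [lifted_change i] differs from [wrap i] by a
    coboundary, and a product of cocycles with a coboundary has total zero. *)
Lemma total_lifted_change t1 t2 :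
  total (steps unit_step (map wrap t1 ++ map lifted_change t2) (@top_cell G 'I_n)) =
  total (steps unit_step (map wrap (t1 ++ t2)) (@top_cell G 'I_n)).
Proof.
elim: t2 t1 => [|i t2 IH] t1; first by rewrite !cats0.
rewrite -cat_rcons -IH map_rcons cat_rcons !steps_cat /=.
rewrite /lifted_change step_form_add stepsD totalD.
rewrite total_steps_coboundary ?add0r// => a /mapP[j _ ->].
  exact: cocycle_wrap.
exact: cocycle_lifted_change.
Qed.

(** Since [wrap i] is carried by edges in direction [i], only the path using the directions in
    increasing order counts. It reaches direction [j] before coordinate [j] has moved, so the
    condition is on [x] itself. *)
Lemma steps_wrap k x (A : {set 'I_n}) : (forall j, (j \in A) = (j < k)%N) ->
  steps unit_step (map wrap (drop k (enum 'I_n))) (@top_cell G 'I_n) x A =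
  [forall j : 'I_n, (k <= j)%N ==> (x ord0 j == ord_max)]%:R.
Proof.
have [m] := ubnP (n - k)%N; elim: m k x A => // m IH k x A mk AE.
have [nk|kn] := leqP n k.
  rewrite drop_oversize ?size_enum_ord//= /top_cell; congr (nat_of_bool _)%:R.
  transitivity true; [apply/eqP|apply/esym/forallP => j].
    by apply/setP => j; rewrite AE inE (leq_trans _ nk).
  by rewrite leqNgt (leq_trans _ nk).
pose i := Ordinal kn; have dE : drop k (enum 'I_n) = i :: drop k.+1 (enum 'I_n).
  rewrite (drop_nth i) ?size_enum_ord//; congr (_ :: _).
  by apply/val_inj; rewrite /= nth_enum_ord.
rewrite dE /= /step (bigD1 i) /=; last by rewrite AE ltnn.
rewrite big1 ?addr0 => [|j /andP[_ ji]]; last by rewrite /wrap (negbTE ji) mul0r.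
rewrite IH; first last.
- move=> j; rewrite !inE AE ltnS [RHS]leq_eqVlt; congr (_ || _).
- by rewrite -ltnS; apply: leq_trans mk; rewrite ltnS ltn_sub2l.
rewrite /wrap eqxx /= -natrM mulnb; congr (nat_of_bool _)%:R.
apply/andP/forallP => [[/eqP xi /forallP H] j|H].
  apply/implyP; rewrite leq_eqVlt => /orP[/eqP kj|kj].
    by rewrite (_ : j = i) ?xi//; apply/val_inj.
  move: (H j); rewrite kj /= unit_stepE (_ : (j == i) = false) ?addr0 //.
  by apply/negbTE/eqP => ji; move: kj; rewrite ji ltnn.
split; first by apply: (implyP (H i)).
apply/forallP => j; apply/implyP => kj; rewrite unit_stepE.
rewrite (_ : (j == i) = false) ?addr0; last first.
  by apply/negbTE/eqP => ji; move: kj; rewrite ji ltnn.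
by apply: (implyP (H j)); apply: ltnW.
Qed.

(** Exactly one cube contributes, the one based at the vertex with all coordinates [ord_max]. *)
Lemma total_wrap : total (steps unit_step (map wrap (enum 'I_n)) (@top_cell G 'I_n)) = 1.
Proof.
have E (x : G) : steps unit_step (map wrap (enum 'I_n)) (@top_cell G 'I_n) x finset.set0 =
    [forall j : 'I_n, x ord0 j == ord_max]%:R.
  have /= := @steps_wrap 0 x finset.set0; rewrite drop0 => -> // j.
  by rewrite inE.
rewrite /total (bigD1 (\row__ ord_max)) //= E.
rewrite (_ : [forall _, _]); last by apply/forallP => j; rewrite mxE eqxx.
rewrite big1 ?addr0 // => x xmax; rewrite E.
case: forallP => // H; case/eqP: xmax; apply/rowP => j; rewrite mxE.
exact/eqP/H.
Qed.

Lemma sum_unit_step (B : {set 'I_n}) i : (\sum_(l in B) unit_step l) ord0 i = (i \in B)%:R.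
Proof.
rewrite summxE; under eq_bigr do rewrite mxE.
case: (boolP (i \in B)) => iB; last first.
  by rewrite big1 // => l lB; case: eqP => // il; move: iB; rewrite il lB.
rewrite (bigD1 i) //= eqxx big1 ?addr0 // => l /andP[_ li].
by rewrite eq_sym (negbTE li).
Qed.

Lemma vertexE (x : G) (B : {set 'I_n}) i :
  (x + \sum_(l in B) unit_step l) ord0 i = x ord0 i + (i \in B)%:R.
Proof. by rewrite !mxE -sum_unit_step. Qed.

Lemma ord_maxD1 : (ord_max : 'I_N.+2) + 1 = 0.
Proof. by apply/val_inj; rewrite /= ?(@modn_small 1) // addn1 modnn. Qed.

(** Discrete Poincare-Miranda. The total for the lifted changes is 1, so some cube contributes, and
    each lifted change is nonzero on one of its edges; as this cube does not wrap around, that edge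
    is a genuine sign change. *)
Lemma grid_sign_change : exists x : G, forall i, exists w w' : G,
  [/\ forall l, (x ord0 l <= w ord0 l <= x ord0 l + 1)%N, forall l, (x ord0 l <= w' ord0 l <= x ord0 l + 1)%N,
      s i w = false & s i w' = true].
Proof.
have := total_lifted_change [::] (enum 'I_n); rewrite /= total_wrap => T1.
have [/existsP[x xne0]|/existsPn none] := boolP [exists x, steps unit_step
   (map lifted_change (enum 'I_n)) (@top_cell G 'I_n) x finset.set0 != 0]; last first.
  move: T1; rewrite /total big1 // => [x _]; apply/eqP.
  by move: (none x); rewrite negbK.
exists x.
have {}xne0 i : exists (B : {set 'I_n}) j,
    j \notin B /\ lifted_change i (x + \sum_(l in B) unit_step l) j != 0.
  apply: (steps_neq0 (A := finset.set0)); first by rewrite big_set0 addr0; exact: xne0.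
  by apply: map_f; rewrite mem_enum.
(* If coordinate [i] of [x] were [ord_max], an edge of the cube in direction [i] would get 1 from
   the jump of [s i] and 1 from [wrap], and any other edge 0 from both. *)
have xmax i : x ord0 i != ord_max.
  apply/eqP => xi; have [B [j [jB]]] := xne0 i; case/eqP.
  rewrite /lifted_change /sign_change /coboundary /wrap.
  set y := x + _.
  have yi : y ord0 i = if i \in B then 0 else ord_max.
    by rewrite [LHS]vertexE xi; case: ifP; rewrite ?addr0// ord_maxD1.
  have [ji|ji] := eqVneq j i.
    move: yi; rewrite -ji (negbTE jB) => yj; rewrite [s j y]s1 // s0 ?addr0 ?yj ?eqxx ?F2_addxx//.
    by rewrite unit_stepE eqxx yj ord_maxD1.
  have y'i : (y + unit_step j) ord0 i = y ord0 i by rewrite unit_stepE eq_sym (negbTE ji) addr0.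
  rewrite addr0; move: y'i; rewrite yi; case: ifP => iB y'i.
    by rewrite s0 ?[s i (_ + _)]s0 ?addr0// yi iB.
  by rewrite s1 ?[s i (_ + _)]s1 ?F2_addxx// yi iB.
(* Addition in ['I_N.+2] is cyclic; below [ord_max] adding 1 is the successor of natural numbers. *)
have succE i : (x ord0 i + 1 : 'I_N.+2) = (x ord0 i).+1 :> nat.
  rewrite /= modn_small ?addn1//.
  have := ltn_ord (x ord0 i); rewrite ltnS leq_eqVlt => /orP[/eqP|//].
  by move=> E; case/eqP: (xmax i); apply/val_inj.
have near_cube (B : {set 'I_n}) l :
    (x ord0 l <= (x + \sum_(l in B) unit_step l)%R ord0 l <= x ord0 l + 1)%N.
  rewrite [X in (_ <= nat_of_ord X <= _)%N]vertexE; case: (l \in B); first by rewrite succE addn1 leqnSn leqnn.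
  by rewrite addr0 leqnn leq_addr.
move=> i; have [B [j [jB]]] := xne0 i.
have E : x + \sum_(l in B) unit_step l + unit_step j =
         x + \sum_(l in (j |: B)%SET) unit_step l.
  by rewrite big_setU1 //= -addrA; congr (_ + _); rewrite addrC.
rewrite /lifted_change /sign_change /coboundary /wrap E.
have [ji|_] := eqVneq j i.
  rewrite vertexE -ji (negbTE jB) addr0 (negbTE (xmax _)) addr0.
  case s1E: (s j _); case s2E: (s j _) => // _.
  - by exists (x + \sum_(l in (j |: B)%SET) unit_step l), (x + \sum_(l in B) unit_step l).
  - by exists (x + \sum_(l in B) unit_step l), (x + \sum_(l in (j |: B)%SET) unit_step l).
rewrite addr0; case s1E: (s i _); case s2E: (s i _) => // _.
- by exists (x + \sum_(l in (j |: B)%SET) unit_step l), (x + \sum_(l in B) unit_step l).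
- by exists (x + \sum_(l in B) unit_step l), (x + \sum_(l in (j |: B)%SET) unit_step l).
Qed.

End Grid.

(** * The Poincare-Miranda theorem *)

Section PoincareMiranda.
Variables (R : realType) (n : nat).

Lemma grid_approximation (a b : R) (f : 'rV[R]_n -> 'rV[R]_n) (N : nat) : a < b ->
  (forall (x : 'rV[R]_n) i, x ord0 i = a -> f x ord0 i < 0) ->
  (forall (x : 'rV[R]_n) i, x ord0 i = b -> 0 < f x ord0 i) ->
  exists q : 'rV[R]_n, (forall i, a <= q ord0 i <= b) /\
    forall i, exists w w' : 'rV[R]_n,
      [/\ forall l, `|q ord0 l - w ord0 l| <= (b - a) / N.+1%:R,
          forall l, `|q ord0 l - w' ord0 l| <= (b - a) / N.+1%:R,
          f w ord0 i <= 0 & 0 < f w' ord0 i].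
Proof.
move=> ab fa fb.
(* The [N.+2] indices bound [N.+1] intervals, so [0] and [ord_max] land exactly on [a] and [b]. *)
pose p (v : 'rV['I_N.+2]_n) : 'rV[R]_n :=
  \row_l (a + (b - a) / N.+1%:R * (v ord0 l : nat)%:R).
pose s i v := 0 < f (p v) ord0 i.
have N0 : N.+1%:R != 0 :> R by rewrite pnatr_eq0.
have [v i vi|v i vi|x xP] := @grid_sign_change n N s.
- by apply/negbTE; rewrite -leNgt ltW // fa // mxE vi /= mulr0 addr0.
- by apply: fb; rewrite mxE vi /= mulfVK // addrCA subrr addr0.
have d0 : 0 <= (b - a) / N.+1%:R by rewrite divr_ge0 // subr_ge0 ltW.
have pdist (w : 'rV['I_N.+2]_n) : (forall l, (x ord0 l <= w ord0 l <= x ord0 l + 1)%N) ->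
    forall l, `|p x ord0 l - p w ord0 l| <= (b - a) / N.+1%:R.
  move=> xw l; rewrite !mxE opprD addrACA subrr add0r -mulrBr normrM (ger0_norm d0).
  have /andP[h1 h2] := xw l.
  rewrite ler_piMr // distrC ger0_norm ?subr_ge0 ?ler_nat //.
  by rewrite lerBlDl natr1 ler_nat -[(x ord0 l).+1]addn1.
exists (p x); split=> [i|i].
  rewrite mxE lerDl mulr_ge0 //= -lerBrDl -mulrA ler_piMr ?subr_ge0 ?(ltW ab)//.
  by rewrite mulrC ler_pdivrMr ?ltr0n// mul1r ler_nat -ltnS.
have [w [w' [xw xw' sw sw']]] := xP i.
by exists (p w), (p w'); split=> //; [exact: pdist | exact: pdist | rewrite leNgt -/(s i w) sw].
Qed.

(** At a cluster point [c] of the approximations [q N], a nonzero coordinate of [f c] would keep its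
    sign nearby, whereas the grid points around [q N] show both signs. *)
Lemma poincare_miranda (a b : R) (f : 'rV[R]_n -> 'rV[R]_n) : a < b ->
  continuous f ->
  (forall (x : 'rV[R]_n) i, x ord0 i = a -> f x ord0 i < 0) ->
  (forall (x : 'rV[R]_n) i, x ord0 i = b -> 0 < f x ord0 i) ->
  exists x, f x = 0.
Proof.
move=> ab fc fa fb.
have [q qP] := choice (fun N => @grid_approximation a b f N ab fa fb).
have Kc : compact [set v : 'rV[R]_n | forall i, v ord0 i \in `[a, b]].
  exact: (@rV_compact R n (fun=> `[a, b]%classic) (fun=> @segment_compact R a b)).
have [|c [_ cl]] := Kc (q @ \oo) _ _.
  by exists 0%N => // N _ i /=; rewrite in_itv/=; apply: (qP N).1.
exists c; apply/rowP => i; rewrite mxE; apply/eqP/negPn/negP => fi0.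
have ci : continuous (fun x => f x ord0 i).
  move=> x; apply: (@continuous_comp _ _ _ f (fun y => y ord0 i)); first exact: fc.
  exact: coord_continuous.
(* Half of [e] bounds the distance from [c] to [q N], the other half the mesh. *)
have close e : 0 < e -> exists N, forall w : 'rV[R]_n, (forall l, `|q N ord0 l - w ord0 l| <= (b - a) / N.+1%:R) ->
    ball c e w.
  move=> e0.
  have [N0 N0P] : exists N0, forall N, (N0 <= N)%N -> (b - a) / N.+1%:R < e / 2.
    exists (Num.truncn ((b - a) / (e / 2))) => N NN.
    rewrite ltr_pdivrMr ?ltr0n// mulrC -ltr_pdivrMr ?divr_gt0//.
    apply: lt_le_trans (truncnS_gt _) _; rewrite ler_nat ltnS //.
  have [|_ [[N NN0 <-] cq]] := cl [set q N | N in [set N | (N0 <= N)%N]] (ball c (e / 2)) _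
      (nbhsx_ballx c _ (divr_gt0 e0 (ltr0n _ 2))).
    by exists N0 => // N /= NN; exists N.
  exists N => w wq.
  rewrite [e]splitr; apply: ball_triangle cq _; split; first by rewrite divr_gt0.
  move=> j l; rewrite (ord1 j); exact: le_lt_trans (wq l) (N0P _ NN0).
move: fi0; rewrite neq_lt => /orP[lt0|gt0].
- have : nbhs c ((fun x => f x ord0 i) @^-1` [set y | y < 0]) by apply: ci; exact: lt_nbhsl lt0.
  move=> /nbhs_ballP[e /= e0 eP].
  have [N NP] := close e e0; have [w [w' [_ /NP/eP /= h _ h']]] := (qP N).2 i.
  by move: (lt_trans h h'); rewrite ltxx.
- have : nbhs c ((fun x => f x ord0 i) @^-1` [set y | 0 < y]) by apply: ci; exact: lt_nbhsr gt0.
  move=> /nbhs_ballP[e /= e0 eP].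
  have [N NP] := close e e0; have [w [w' [/NP/eP /= h _ h' _]]] := (qP N).2 i.
  by move: (lt_le_trans h h'); rewrite ltxx.
Qed.

End PoincareMiranda.

(** * Balls and their boundaries *)

Section EuclideanNorm.
Variables (R : realType) (n : nat).
Implicit Types x y : 'rV[R]_n.

(** The built-in norm on row vectors is the maximum norm; the balls here are Euclidean. *)
Definition enorm x : R := Num.sqrt (\sum_i x ord0 i ^+ 2).

Lemma enorm_ge0 x : 0 <= enorm x. Proof. exact: sqrtr_ge0. Qed.

Lemma sum_sqr_ge0 x : 0 <= \sum_i x ord0 i ^+ 2.
Proof. by apply: sumr_ge0 => i _; apply: sqr_ge0. Qed.

Lemma unit_ballE x : unit_ball R n x <-> enorm x <= 1.
Proof.
rewrite /unit_ball /= -(ler_sqrt _ ler01) sqrtr1; split=> //.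
Qed.

Lemma unit_sphereE x : unit_sphere R n x <-> enorm x = 1.
Proof.
rewrite /unit_sphere /= /enorm; split=> [->|]; first exact: sqrtr1.
by move=> /(congr1 (fun r => r ^+ 2)); rewrite sqr_sqrtr ?sum_sqr_ge0// expr1n.
Qed.

Lemma enormZ t x : enorm (t *: x) = `|t| * enorm x.
Proof.
rewrite /enorm -sqrtr_sqr -sqrtrM ?sqr_ge0// mulr_sumr.
by congr Num.sqrt; apply: eq_bigr => i _; rewrite mxE exprMn.
Qed.

Lemma enormZ_ge0 t x : 0 <= t -> enorm (t *: x) = t * enorm x.
Proof. by move=> t0; rewrite enormZ ger0_norm. Qed.

Lemma coord_le_enorm x i : `|x ord0 i| <= enorm x.
Proof.
rewrite -sqrtr_sqr ler_sqrt ?sum_sqr_ge0// (bigD1 i) //= lerDl.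
by apply: sumr_ge0 => j _; apply: sqr_ge0.
Qed.

Lemma enorm_eq0 x : enorm x = 0 -> x = 0.
Proof.
move=> x0; apply/rowP => i; rewrite mxE; apply/eqP.
by rewrite -normr_le0 -x0 coord_le_enorm.
Qed.

Lemma enorm0 : enorm 0 = 0.
Proof. by rewrite -(scale0r 0) enormZ_ge0 ?mul0r. Qed.

Lemma norm_le_enorm x : `|x| <= enorm x.
Proof.
rewrite [`|x|]mx_normrE; apply/bigmax_leP; split; first exact: enorm_ge0.
by move=> [i j] _; rewrite (ord1 i); exact: coord_le_enorm.
Qed.

Lemma continuous_enorm : continuous enorm.
Proof.
have sum_cont : continuous (fun x : 'rV[R]_n => \sum_i x ord0 i ^+ 2).
  apply: continuous_big => [|i _ x]; first exact: add_continuous.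
  apply: (@continuous_comp _ _ _ (fun x => x ord0 i) (fun y : R => y ^+ 2)).
    exact: coord_continuous.
  exact: exprn_continuous.
move=> x; apply: (@continuous_comp _ _ _ _ _ x (sum_cont x)).
exact: sqrt_continuous.
Qed.

Lemma compact_unit_ball : compact (unit_ball R n).
Proof.
apply: bounded_closed_compact.
  exists 1; split; [exact: num_real | move=> M M1 x /unit_ballE x1].
  by apply: (le_trans (norm_le_enorm x)); rewrite (le_trans x1)// ltW.
have -> : unit_ball R n = enorm @^-1` [set r | r <= 1].
  by apply/seteqP; split=> x /unit_ballE.
by apply: closed_comp => [x _|]; [exact: continuous_enorm | exact: closed_le].
Qed.

Lemma sphere_sub_ball : unit_sphere R n `<=` unit_ball R n.
Proof. by move=> x /unit_sphereE x1; apply/unit_ballE; rewrite x1. Qed.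

Lemma ball0 : unit_ball R n 0.
Proof. by apply/unit_ballE; rewrite enorm0. Qed.

Lemma normalize_sphere x : x != 0 -> unit_sphere R n ((enorm x)^-1 *: x).
Proof.
move=> x0; apply/unit_sphereE; rewrite enormZ_ge0 ?invr_ge0 ?enorm_ge0// mulVf//.
by apply: contra_neq x0; exact: enorm_eq0.
Qed.

Lemma enorm_gt0 x : x != 0 -> 0 < enorm x.
Proof.
by move=> x0; rewrite lt_def enorm_ge0 andbT; apply: contra_neq x0; exact: enorm_eq0.
Qed.

End EuclideanNorm.

Section Within.
Implicit Types T U V : topologicalType.

Lemma withinP T U (A : set T) (f : T -> U) : {within A, continuous f} <->
  forall x, A x -> forall W, nbhs (f x) W -> \forall z \near x, A z -> W (f z).
Proof. exact: subspace_continuousP. Qed.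

Lemma within_comp T U V (A : set T) (B : set U) (f : T -> U) (g : U -> V) :
  {within A, continuous f} -> {within B, continuous g} -> (forall x, A x -> B (f x)) ->
  {within A, continuous (g \o f)}.
Proof.
move=> /withinP cf /withinP cg AB; apply/withinP => x Ax W gW.
have := cf x Ax _ (cg _ (AB x Ax) _ gW).
by apply: filterS => z h Az; apply: h => //; exact: AB.
Qed.

Lemma within_eq T U (A : set T) (f g : T -> U) : (forall x, A x -> f x = g x) ->
  {within A, continuous f} -> {within A, continuous g}.
Proof.
move=> fg /withinP cf; apply/withinP => x Ax W; rewrite -fg // => gW.
by have := cf x Ax W gW; apply: filterS => z h Az; rewrite -fg //; exact: h.
Qed.

Lemma continuous_withinT T U (f : T -> U) : {within setT, continuous f} -> continuous f.
Proof.
move=> /withinP cf x W fW.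
by have := cf x I W fW; apply: filterS => z; apply.
Qed.

End Within.

Section BallBoundary.
Variable R : realType.

(* [h] carries the complement of [x0] onto that of [h x0], which is star-shaped
   around [0] when [h x0] lies on the sphere; contracting the sphere there gives
   a never vanishing extension of the identity field [z - x0]. *)
Lemma homeo_ball_sphere n m (h : 'rV[R]_n -> 'rV[R]_m) (x0 : 'rV[R]_n) :
  homeo_on (unit_ball R n) (unit_ball R m) h ->
  unit_ball R n x0 -> unit_sphere R m (h x0) -> unit_sphere R n x0.
Proof.
move=> [g [hc gc hD gh hg]] /[dup] Dx0 /unit_ballE x0le1 /unit_sphereE hx0.
apply: contrapT => nS; have x0lt1 : enorm x0 < 1.
  by rewrite lt_neqAle x0le1 andbT; apply/eqP => /unit_sphereE.
(* [rho] retracts onto the unit ball, and [t] rises from 0 at norm 1 to 1 at norm 2, so [w z] moves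
   along the radius from [0] to [h (rho z)]. From norm 2 on, [g (w z)] is [rho z], and the second
   summand of [F] makes it grow outwards. *)
pose r (z : 'rV[R]_n) : R := Num.max 1 (enorm z).
pose rho z := (r z)^-1 *: z.
pose t (z : 'rV[R]_n) : R := Num.min 1 (Num.max 0 (enorm z - 1)).
pose w z := t z *: h (rho z).
pose F z := g (w z) + Num.max 0 (enorm z - 2) *: rho z - x0.
have hball z : unit_ball R n z -> unit_ball R m (h z) by move=> Dz; rewrite -hD; exists z.
have r1 z : 1 <= r z by rewrite /r le_max lexx.
have r0 z : 0 < r z by rewrite (lt_le_trans ltr01).
have Drho z : unit_ball R n (rho z).
  apply/unit_ballE; rewrite enormZ_ge0 ?invr_ge0 ?(ltW (r0 z))//.
  by rewrite ler_pdivrMl// mulr1 /r le_max lexx orbT.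
have t01 z : 0 <= t z <= 1 by rewrite /t ge_min lexx le_min ler01 le_max lexx.
have ehle z : enorm (h (rho z)) <= 1 by apply/unit_ballE/hball.
have ewt z : enorm (w z) <= t z.
  have /andP[t0 _] := t01 z.
  by rewrite enormZ_ge0// ler_piMr.
have Dw z : unit_ball R m (w z).
  by apply/unit_ballE; rewrite (le_trans (ewt z)) //; have /andP[] := t01 z.
have cr : continuous r.
  move=> z; apply: (@continuous_max _ _ (fun=> 1) (@enorm R n)); first exact: cst_continuous.
  exact: continuous_enorm.
have crho : continuous rho.
  move=> z; apply: (continuousZ (s := fun z => (r z)^-1) (f := id)); last exact: cvg_id.
  by apply: continuousV; [rewrite gt_eqF | exact: cr].
have cpos c : continuous (fun z : 'rV[R]_n => Num.max 0 (enorm z - c)).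
  move=> z; apply: (@continuous_max _ _ (fun=> 0) (fun z => enorm z - c)); first exact: cst_continuous.
  by apply: (continuousB (f := @enorm R n) (g := fun=> c)); [exact: continuous_enorm | exact: cst_continuous].
have ct : continuous t.
  move=> z; apply: (@continuous_min _ _ (fun=> 1) (fun z => Num.max 0 (enorm z - 1))).
    exact: cst_continuous.
  exact: cpos.
have cw : continuous w.
  move=> z; apply: (continuousZ (s := t) (f := h \o rho)); first exact: ct.
  apply: continuous_withinT; apply: within_comp hc _; last by move=> ? _; exact: Drho.
  exact: continuous_subspaceT.
have cF : continuous F.
  move=> z; apply: (continuousB (f := fun z => (g \o w) z + _ *: _) (g := fun=> x0)); last exact: cst_continuous.
  apply: (continuousD (f := g \o w) (g := fun z => Num.max 0 (enorm z - 2) *: rho z)).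
    apply: continuous_withinT; apply: within_comp gc _; last by move=> ? _; exact: Dw.
    exact: continuous_subspaceT.
  by apply: (continuousZ (s := fun z => Num.max 0 (enorm z - 2)) (f := rho)); [exact: cpos | exact: crho].
have far z : 2 <= enorm z -> F z = (1 - (enorm z)^-1) *: z - x0.
  move=> z2; have rE : r z = enorm z by rewrite /r max_r //; lra.
  have tE : t z = 1.
    rewrite /t [Num.max 0 _]max_r; last by lra.
    by rewrite min_l //; lra.
  rewrite /F /w tE scale1r gh // max_r; last by lra.
  rewrite /rho rE scalerA -scalerDl; congr (_ *: _ - _); field.
  by apply/eqP; lra.
have x0i i : `|x0 ord0 i| < 1 by rewrite (le_lt_trans (coord_le_enorm _ _)).
(* On the faces of the cube of half-side 3 the factor is at least 2/3, so [a * z_i] has size at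
   least 2 and dominates the coordinate of [x0]. *)
have big (z : 'rV[R]_n) (i : 'I_n) : 3 <= `|z ord0 i| ->
    exists2 a, 2 / 3 <= a & F z ord0 i = a * z ord0 i - x0 ord0 i.
  move=> z3; have z3' : 3 <= enorm z by rewrite (le_trans z3)// coord_le_enorm.
  exists (1 - (enorm z)^-1); last by rewrite far ?mxE //; lra.
  have : (enorm z)^-1 <= 3^-1 by rewrite lef_pV2 ?posrE //; lra.
  lra.
have [||||z Fz] := @poincare_miranda R n (-3) 3 F.
- by lra.
- by [].
- move=> z i zi; have [|a a0 ->] := big z i; first by rewrite zi normrN ger0_norm.
  by have := x0i i; rewrite zi ltr_norml => /andP[]; lra.
- move=> z i zi; have [|a a0 ->] := big z i; first by rewrite zi ger0_norm.
  by have := x0i i; rewrite zi ltr_norml => /andP[]; lra.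
(* A zero of norm at least 2 would give [enorm x0 = enorm z - 1 >= 1]; a zero of smaller norm would
   give [w z = h x0], of norm 1, although [enorm (w z) <= t z < 1]. *)
have [z2|z2] := leP 2 (enorm z).
  move: Fz; rewrite far // => /eqP; rewrite subr_eq0 => /eqP x0E.
  have iz : (enorm z)^-1 <= 1 by rewrite invf_le1; lra.
  move: x0lt1; rewrite -x0E enormZ_ge0 ?subr_ge0// mulrBl mul1r mulVf; first by lra.
  by apply/eqP; lra.
move: Fz; rewrite /F max_l; last by lra.
rewrite scale0r addr0 => /eqP; rewrite subr_eq0 => /eqP gw.
have := ewt z; rewrite -(hg _ (Dw z)) gw hx0 /t le_min lexx le_max /=; lra.
Qed.

End BallBoundary.

(** * Gluing and coning homeomorphisms *)

Section Homeo.
Implicit Types T U V : topologicalType.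

Lemma homeo_image T U (A : set T) (B : set U) f : homeo_on A B f -> forall x, A x -> B (f x).
Proof. by move=> [g [_ _ <- _ _]] x Ax; exists x. Qed.

Lemma homeo_inverse T U (A : set T) (B : set U) f : homeo_on A B f ->
  exists g, [/\ homeo_on B A g, forall x, A x -> g (f x) = x & forall y, B y -> f (g y) = y].
Proof.
move=> [g [fc gc fAB gf fg]]; exists g; split=> //; exists f; split=> //.
apply/seteqP; split=> [_ [y By <-]|x Ax].
  by move: By; rewrite -fAB => -[x Ax <-]; rewrite gf.
by exists (f x); rewrite ?gf // -fAB; exists x.
Qed.

Lemma homeo_comp T U V (A : set T) (B : set U) (C : set V) f g :
  homeo_on A B f -> homeo_on B C g -> homeo_on A C (g \o f).
Proof.
move=> hf hg; have fB := homeo_image hf; have gC := homeo_image hg.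
move: hf hg => [f' [fc f'c fAB f'f ff']] [g' [gc g'c gBC g'g gg']].
have g'B y : C y -> B (g' y) by rewrite -gBC => -[x Bx <-]; rewrite g'g.
exists (f' \o g'); split.
- exact: within_comp fc gc _.
- exact: within_comp g'c f'c _.
- by rewrite -image_comp fAB.
- by move=> x Ax /=; rewrite g'g ?f'f //; exact: fB.
- by move=> y Cy /=; rewrite ff' ?gg' //; exact: g'B.
Qed.

Lemma homeo_restrict T U (A A0 : set T) (B : set U) f :
  A0 `<=` A -> homeo_on A B f -> homeo_on A0 (f @` A0) f.
Proof.
move=> A0A [g [fc gc fAB gf fg]]; exists g; split=> //.
- exact: continuous_subspaceW fc.
- by apply: continuous_subspaceW gc => _ [x /A0A Ax <-]; rewrite -fAB; exists x.
- by move=> x /A0A; exact: gf.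
- by move=> _ [x /A0A Ax <-]; rewrite gf.
Qed.

(** Pasting on closed sets is applied to the maps and to their inverses; the last hypothesis makes
    the inverses agree on the overlap. *)
Lemma homeo_glue T U (A B : set T) (A' B' : set U) f g :
  closed A -> closed B -> closed A' -> closed B' ->
  homeo_on A A' f -> homeo_on B B' g ->
  (forall x, A x -> B x -> f x = g x) -> A' `&` B' `<=` f @` (A `&` B) ->
  exists k, [/\ homeo_on (A `|` B) (A' `|` B') k, forall x, A x -> k x = f x &
    forall x, B x -> k x = g x].
Proof.
move=> cA cB cA' cB' hf hg fg AB'.
have fA := homeo_image hf; have gB := homeo_image hg.
move: hf hg => [f' [fc f'c fAB f'f ff']] [g' [gc g'c gBC g'g gg']].
have f'g' y : A' y -> B' y -> f' y = g' y.
  move=> A'y B'y; have [x [Ax Bx] <-] := AB' y (conj A'y B'y).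
  by rewrite f'f // fg // g'g.
have glueP (T1 U1 : topologicalType) (D E : set T1) (p q : T1 -> U1) :
    (forall x, D x -> E x -> p x = q x) -> closed D -> closed E ->
    {within D, continuous p} -> {within E, continuous q} ->
    exists k : T1 -> U1, [/\ {within D `|` E, continuous k}, forall x, D x -> k x = p x & forall x, E x -> k x = q x].
  move=> pq cD cE pc qc; pose k x := if `[< D x >] then p x else q x.
  have kD x : D x -> k x = p x by move=> Dx; rewrite /k asboolT.
  have kE x : E x -> k x = q x.
    by move=> Ex; rewrite /k; case: asboolP => // Dx; exact: pq.
  exists k; split=> //; apply: withinU_continuous => //.
    by apply: within_eq pc => x /kD.
  by apply: within_eq qc => x /kE.
have [k [kc kA kB]] := glueP _ _ A B f g fg cA cB fc gc.
have [k' [k'c k'A k'B]] := glueP _ _ A' B' f' g' f'g' cA' cB' f'c g'c.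
have f'A y : A' y -> A (f' y) by rewrite -fAB => -[x Ax <-]; rewrite f'f.
have g'B y : B' y -> B (g' y) by rewrite -gBC => -[x Bx <-]; rewrite g'g.
exists k; split=> //; exists k'; split=> //.
- rewrite image_setU -fAB -gBC; congr (_ `|` _).
    by apply/seteqP; split=> _ [x Ax <-]; exists x => //; rewrite kA.
  by apply/seteqP; split=> _ [x Ax <-]; exists x => //; rewrite kB.
- by move=> x [Ax|Bx]; [rewrite kA // k'A ?f'f //; exact: fA|rewrite kB // k'B ?g'g //; exact: gB].
- by move=> y [Ay|By]; [rewrite k'A // kA ?ff' //; exact: f'A|rewrite k'B // kB ?gg' //; exact: g'B].
Qed.

End Homeo.

Section Cone.
Variable R : realType.

(** The radial extension of a map of spheres. At the origin the inverse is 0 by convention, and the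
    factor [enorm x] kills the arbitrary value [h 0]. *)
Definition cone n m (h : 'rV[R]_n -> 'rV[R]_m) x := enorm x *: h ((enorm x)^-1 *: x).

Lemma cone0 n m (h : 'rV[R]_n -> 'rV[R]_m) : cone h 0 = 0.
Proof. by rewrite /cone enorm0 scale0r. Qed.

Lemma cone_polar n m (h : 'rV[R]_n -> 'rV[R]_m) u t : unit_sphere R n u -> 0 <= t ->
  cone h (t *: u) = t *: h u.
Proof.
move=> /unit_sphereE u1 t0; rewrite /cone enormZ_ge0 // u1 mulr1.
have [->|tn0] := eqVneq t 0; first by rewrite !scale0r.
by rewrite scalerA mulVf // scale1r.
Qed.

Lemma polar n (x : 'rV[R]_n) : unit_ball R n x ->
  x = 0 \/ exists u t, [/\ unit_sphere R n u, 0 < t, t <= 1 & x = t *: u].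
Proof.
move=> /unit_ballE x1; have [->|x0] := eqVneq x 0; [by left|right].
exists ((enorm x)^-1 *: x), (enorm x); split=> //.
- exact: normalize_sphere.
- exact: enorm_gt0.
- by rewrite scalerA mulfV ?scale1r // gt_eqF // enorm_gt0.
Qed.

Lemma scale_sphere_ball n u (t : R) : unit_sphere R n u -> 0 <= t <= 1 -> unit_ball R n (t *: u).
Proof.
by move=> /unit_sphereE u1 /andP[t0 t1]; apply/unit_ballE; rewrite enormZ_ge0 // u1 mulr1.
Qed.

(** At the origin continuity holds because [cone h] preserves [enorm]; elsewhere normalization is
    continuous into the sphere. *)
Lemma continuous_cone n m (h : 'rV[R]_n -> 'rV[R]_m) :
  {within unit_sphere R n, continuous h} ->
  (forall u, unit_sphere R n u -> unit_sphere R m (h u)) -> continuous (cone h).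
Proof.
move=> hc hS x; have [->|x0] := eqVneq x 0.
  move=> W; rewrite cone0 => /nbhs_ballP[e /= e0 eW].
  have : \forall z \near (0 : 'rV[R]_n), enorm z < e.
    have c0 := @continuous_enorm R n 0.
    apply: (c0 [set r | r < e]); rewrite enorm0; exact: lt_nbhsl.
  apply: (@filterS _ (nbhs (0 : 'rV[R]_n)) _) => z ze.
  apply: eW; rewrite mx_norm_ball /ball_/= sub0r normrN.
  apply: le_lt_trans (norm_le_enorm _) _.
  have [->|z0] := eqVneq z 0; first by rewrite cone0 enorm0.
  rewrite /cone enormZ_ge0 ?enorm_ge0 //.
  by have /unit_sphereE -> := hS _ (normalize_sphere z0); rewrite mulr1.
have : {within [set z | z != 0], continuous (h \o (fun z => (enorm z)^-1 *: z))}.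
  apply: within_comp hc _; last by move=> z; exact: normalize_sphere.
  apply/withinP => z /= z0 W.
  have cz : {for z, continuous (fun z : 'rV[R]_n => (enorm z)^-1 *: z)}.
    apply: (continuousZ (s := fun z => (enorm z)^-1) (f := id)); last exact: cvg_id.
    by apply: continuousV; [rewrite gt_eqF // enorm_gt0 | exact: continuous_enorm].
  by move=> zW; apply: (@filterS _ (nbhs z) _ _ _ _ (cz W zW)) => y ? _.
move=> /withinP/(_ x x0) hx.
have nx0 : \forall z \near x, z != 0.
  have := @continuous_enorm R n x [set r | 0 < r] (lt_nbhsr (enorm_gt0 x0)).
  by apply: (@filterS _ (nbhs x) _) => z /= z0; apply: contraTneq z0 => ->; rewrite enorm0 ltxx.
have cx : {for x, continuous (h \o (fun z => (enorm z)^-1 *: z))}.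
  by move=> W /hx hW; apply: (@filterS2 _ (nbhs x) _ _ _ _ _ nx0 hW) => z z0; apply.
by apply: (continuousZ (s := @enorm R n) (f := h \o _)) cx; exact: continuous_enorm.
Qed.

(* Alexander's trick. *)
Lemma homeo_cone n m (h : 'rV[R]_n -> 'rV[R]_m) :
  homeo_on (unit_sphere R n) (unit_sphere R m) h ->
  homeo_on (unit_ball R n) (unit_ball R m) (cone h).
Proof.
move=> /[dup] hh [g [hc gc hS gh hg]].
have hS' := homeo_image hh.
have gS' v : unit_sphere R m v -> unit_sphere R n (g v).
  by rewrite -hS => -[u Su <-]; rewrite gh.
have coneD p q (k : 'rV[R]_p -> 'rV[R]_q) :
    (forall u, unit_sphere R p u -> unit_sphere R q (k u)) ->
    forall x, unit_ball R p x -> unit_ball R q (cone k x).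
  move=> kS x /polar[->|[u [t [Su t0 t1 ->]]]]; first by rewrite cone0; exact: ball0.
  by rewrite cone_polar ?(ltW t0)//; apply: scale_sphere_ball; [exact: kS | rewrite ltW].
have coneK p q (k : 'rV[R]_p -> 'rV[R]_q) k' :
    (forall u, unit_sphere R p u -> unit_sphere R q (k u)) ->
    (forall u, unit_sphere R p u -> k' (k u) = u) ->
    forall x, unit_ball R p x -> cone k' (cone k x) = x.
  move=> kS k'k x /polar[->|[u [t [Su t0 t1 ->]]]]; first by rewrite !cone0.
  by rewrite !cone_polar ?(ltW t0) ?k'k//; exact: kS.
exists (cone g); split.
- exact/continuous_subspaceT/continuous_cone.
- exact/continuous_subspaceT/continuous_cone.
- apply/seteqP; split=> [_ [x Dx <-]|y Dy]; first exact: coneD.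
  by exists (cone g y); [exact: coneD | exact: coneK].
- exact: coneK.
- exact: coneK.
Qed.

(** Read in the charts, [Phi] is a homeomorphism of spheres; its cone is carried back to the cells.
    The last two clauses record that centre and radii are respected, which is what controls [Y]. *)
Lemma cell_extension (X X' : topologicalType) n m (s : set X) (s' : set X')
    (al : 'rV[R]_n -> X) (be : 'rV[R]_m -> X') (Phi : X -> X') :
  homeo_on (unit_ball R n) s al -> homeo_on (unit_ball R m) s' be ->
  homeo_on (al @` unit_sphere R n) (be @` unit_sphere R m) Phi ->
  exists C : X -> X', [/\ homeo_on s s' C,
    forall x, (al @` unit_sphere R n) x -> C x = Phi x,
    C (al 0) = be 0 &
    forall u t, unit_sphere R n u -> 0 <= t <= 1 -> exists v,
      [/\ unit_sphere R m v, Phi (al u) = be v & C (al (t *: u)) = be (t *: v)]].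
Proof.
move=> hal hbe hPhi.
have [al' [hal' al'K alK]] := homeo_inverse hal.
have [be' [hbe' be'K beK]] := homeo_inverse hbe.
have halS := homeo_restrict (@sphere_sub_ball R n) hal.
have hbeS := homeo_restrict (@sphere_sub_ball R m) hbe.
have imS : be' @` (be @` unit_sphere R m) = unit_sphere R m.
  apply/seteqP; split=> [_ [_ [v Sv <-] <-]|v Sv]; first by rewrite be'K //; exact: sphere_sub_ball.
  by exists (be v); [exists v | rewrite be'K //; exact: sphere_sub_ball].
have hbeS' : homeo_on (be @` unit_sphere R m) (unit_sphere R m) be'.
  rewrite -[X in homeo_on _ X]imS; apply: homeo_restrict hbe'.
  by move=> _ [v Sv <-]; apply: (homeo_image hbe); exact: sphere_sub_ball.
have hh := homeo_comp (homeo_comp halS hPhi) hbeS'.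
set h := be' \o _ in hh.
have beh u : unit_sphere R n u -> be (h u) = Phi (al u).
  move=> Su; rewrite /h /= beK //.
  have [v Sv <-] : (be @` unit_sphere R m) (Phi (al u)).
    by apply: (homeo_image hPhi); exists u.
  by apply: (homeo_image hbe); exact: sphere_sub_ball.
have polarC u t : unit_sphere R n u -> 0 <= t <= 1 ->
    (be \o cone h \o al') (al (t *: u)) = be (t *: h u).
  move=> Su t01; rewrite /= al'K; last exact: scale_sphere_ball.
  by rewrite cone_polar //; case/andP: t01.
exists (be \o cone h \o al'); split.
- exact: homeo_comp (homeo_comp hal' (homeo_cone hh)) hbe.
- by move=> _ [u Su <-]; rewrite -[in LHS](scale1r u) polarC ?ler01 ?lexx// scale1r beh.
- by rewrite /= al'K ?cone0 //; exact: ball0.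
- move=> u t Su t01; exists (h u); split; last exact: polarC.
    exact: (homeo_image hh).
  by rewrite beh.
Qed.

End Cone.

(** * Regular CW complexes *)

Section RegularCW.
Variables (R : realType) (X : topologicalType).

(** Two charts differ by a homeomorphism of balls, and [homeo_ball_sphere] forces the preimage of a
    sphere point onto the sphere. *)
Lemma relbdE n (s : set X) (al : 'rV[R]_n -> X) :
  homeo_on (unit_ball R n) s al -> relbd R s = al @` unit_sphere R n.
Proof.
move=> hal; apply/seteqP; split=> x; last by move=> Sx; exists n, al.
move=> [m [be [hbe [v Sv <-]]]].
have Dv := sphere_sub_ball Sv.
have [al' [hal' al'K alK]] := homeo_inverse hal.
have [be' [hbe' be'K beK]] := homeo_inverse hbe.
have sv := homeo_image hbe Dv.
exists (al' (be v)); last by rewrite alK.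
apply: (homeo_ball_sphere (homeo_comp hal hbe')); first exact: (homeo_image hal').
by rewrite /= alK // be'K.
Qed.

Variables (hX : hausdorff_space X) (I : finType) (c : I -> set X).
Hypothesis cCW : regular_CW R c.

Lemma cell_chart i : exists n (al : 'rV[R]_n -> X), homeo_on (unit_ball R n) (c i) al.
Proof. by have [_ _ /(_ i)[n [[al hal] _]]] := cCW; exists n, al. Qed.

Lemma closed_cell i : closed (c i).
Proof.
have [n [al [be [ac _ <- _ _]]]] := cell_chart i.
by apply: compact_closed => //; apply: continuous_compact ac _; exact: compact_unit_ball.
Qed.

Lemma relbd_sub_cell i : relbd R (c i) `<=` c i.
Proof.
have [n [al hal]] := cell_chart i; rewrite (relbdE hal) => _ [u Su <-].
by apply: (homeo_image hal); exact: sphere_sub_ball.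
Qed.

Lemma relint_nonempty i : exists2 x, c i x & ~ relbd R (c i) x.
Proof.
have [n [al hal]] := cell_chart i; exists (al 0).
  by apply: (homeo_image hal); exact: ball0.
rewrite (relbdE hal) => -[u /[dup] Su /unit_sphereE u1].
have [al' [_ al'K _]] := homeo_inverse hal.
move=> /(congr1 al'); rewrite !al'K; [|exact: ball0|exact: sphere_sub_ball].
by move=> u0; move: u1; rewrite u0 enorm0 => /esym/eqP; rewrite oner_eq0.
Qed.

Lemma relbd_proper_cell i x : relbd R (c i) x ->
  exists l, [/\ c l x, l != i & c l `<=` c i].
Proof.
have [_ _ /(_ i)[n [_ [J [bdE _]]]]] := cCW.
rewrite {1}bdE => -[l Jl lx]; exists l; split=> //.
  apply/eqP => li; have [y iy []] := relint_nonempty i.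
  by rewrite bdE; exists l => //; rewrite li.
by apply: classical_sets.subset_trans (@relbd_sub_cell i); rewrite bdE; exact: bigcup_sup.
Qed.

Lemma cell_antisym i j : c i `<=` c j -> c j `<=` c i -> i = j.
Proof. by have [cinj _ _] := cCW => ij ji; apply: cinj; apply/seteqP. Qed.

(** A combinatorial substitute for the dimension: it strictly increases along proper inclusions. *)
Definition cell_rank i := #|[pred j | `[< c j `<=` c i >]]|.

Lemma cell_rank_lt i j : c i `<=` c j -> i != j -> (cell_rank i < cell_rank j)%N.
Proof.
move=> ij nij; apply/proper_card/properP; split.
  apply/fintype.subsetP => l; rewrite !inE => li.
  exact: classical_sets.subset_trans ij.
exists j; rewrite inE //.
by apply/negP => /asboolP ji; move/eqP: nij; apply; exact: cell_antisym.
Qed.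

(** As long as the point is on the relative boundary, pass to a proper face containing it; the rank
    drops. *)
Lemma cell_relint j x : c j x -> exists2 l, c l `<=` c j & relint R (c l) x.
Proof.
have [r] := ubnP (cell_rank j); elim: r j => // r IH j jr jx.
have [bx|nbx] := pselect (relbd R (c j) x); last by exists j.
have [l [lx lj lsub]] := relbd_proper_cell bx.
have [|l' l'l l'x] := IH l _ lx; first exact: leq_trans (cell_rank_lt lsub lj) _.
by exists l' => //; exact: classical_sets.subset_trans lsub.
Qed.

Lemma relint_unique i j x : relint R (c i) x -> relint R (c j) x -> i = j.
Proof. by have [_ /(_ x)[l [_ lu]] _] := cCW => /lu <- /lu. Qed.

(** A point of [c j] is interior to some face [l] of [c j]. Were it also interior to [c i], the
    partition would give [l = i], hence [c i] inside [c j]. *)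
Lemma sub_relbd i j : c j `<=` c i -> j != i -> c j `<=` relbd R (c i).
Proof.
move=> ji nji x jx; apply: contrapT => nx.
have [l lj lx] := cell_relint jx.
have li : l = i by apply: (relint_unique lx); split=> //; exact: ji.
by move/eqP: nji; apply; apply: cell_antisym => //; rewrite -li.
Qed.

(** Used to see that a new cell meets the subcomplex [A] only along its boundary: a common point is
    interior to a cell of [A], hence not to [c i]. *)
Lemma cell_meet_relbd (A : {set I}) i j x :
  (forall a b, a \in A -> c b `<=` c a -> b \in A) -> i \notin A ->
  j \in A -> c j x -> c i x -> relbd R (c i) x.
Proof.
move=> Adown iA jA jx ix; apply: contrapT => nx.
have [l lj lx] := cell_relint jx.
by move: iA; rewrite (relint_unique (conj ix nx) lx) (Adown j l).
Qed.

End RegularCW.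

(** * Extending the homeomorphism cell by cell *)

Section Extension.
Variables (R : realType) (X X' : topologicalType).
Variables (hX : hausdorff_space X) (hX' : hausdorff_space X').
Variables (I : finType) (c : I -> set X) (c' : I -> set X') (k : nat).
Variables (Y : set X) (Y' : set X').
Hypothesis pXY : regular_CW_pair R c k Y.
Hypothesis pXY' : regular_CW_pair R c' k Y'.
Hypothesis c_mono : forall i j, c i `<=` c j <-> c' i `<=` c' j.
Hypothesis meetE : forall i, c i `&` Y !=set0 <-> c' i `&` Y' !=set0.

Let cCW : regular_CW R c := pXY.1.
Let c'CW : regular_CW R c' := pXY'.1.

(** If [Y] misses the cell, [Y'] misses its partner. Otherwise both centres lie in the subspaces,
    and a point off the centre lies in [Y] exactly when the end of its radius does, which [Phi]
    already respects. *)
Lemma extend_to_cell i (Phi : X -> X') :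
  homeo_on (relbd R (c i)) (relbd R (c' i)) Phi ->
  (forall x, relbd R (c i) x -> (Y x <-> Y' (Phi x))) ->
  exists C : X -> X', [/\ homeo_on (c i) (c' i) C,
    forall x, relbd R (c i) x -> C x = Phi x &
    forall x, c i x -> (Y x <-> Y' (C x))].
Proof.
move=> hPhi YPhi.
have [iY|iY] := pXY.2 i.
  have iY' : c' i `&` Y' = set0.
    apply/eqP/negPn/negP => /set0P/meetE; rewrite iY; by case.
  have [n [al hal]] := cell_chart cCW i; have [m [be hbe]] := cell_chart c'CW i.
  rewrite (relbdE hal) (relbdE hbe) in hPhi.
  have [C [hC CPhi _ _]] := cell_extension hal hbe hPhi.
  exists C; split=> //; first by rewrite (relbdE hal).
  move=> x ix; have ix' := homeo_image hC ix; split=> Yx.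
    by have : (c i `&` Y) x by []; rewrite iY.
  by have : (c' i `&` Y') (C x) by []; rewrite iY'.
have [_ [n [al [kn [hal alY]]]]] := iY.
have al0 : c i (al 0) by apply: (homeo_image hal); exact: ball0.
have Y0 : (c i `&` Y) (al 0) by apply/alY => [|? _]; [exact: ball0 | rewrite mxE].
have [i'0|[_ [m [be [km [hbe beY]]]]]] := pXY'.2 i.
  have i'0b : (c' i `&` Y') !=set0 by apply/meetE; exists (al 0).
  by move: i'0b; rewrite i'0 => -[].
have be0 : c' i (be 0) by apply: (homeo_image hbe); exact: ball0.
have Y'0 : (c' i `&` Y') (be 0) by apply/beY => [|? _]; [exact: ball0 | rewrite mxE].
move: hPhi; rewrite (relbdE hal) (relbdE hbe) => hPhi.
have [C [hC CPhi C0 Cpolar]] := cell_extension hal hbe hPhi.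
exists C; split=> //.
have [al' [hal' al'K alK]] := homeo_inverse hal.
move=> x ix; rewrite -(alK x ix); have := homeo_image hal' ix.
set z := al' x => Dz; case: (polar Dz) => [->|[u [t [Su t0 t1 ztu]]]].
  by rewrite C0; split=> _; [case: Y'0 | case: Y0].
have t01 : 0 <= t <= 1 by rewrite (ltW t0).
have [v [Sv Phiu Ctu]] := Cpolar u t Su t01.
(* The equations [x_j = 0] for [j < k] are invariant under scaling by [t > 0]. *)
have scaleY (p : nat) (D : set 'rV[R]_p) (Z : topologicalType) (s W : set Z) (ga : 'rV[R]_p -> Z) w :
    (forall x, unit_ball R p x -> ((s `&` W) (ga x) <-> forall j : 'I_p, (j < k)%N -> x ord0 j = 0)) ->
    (forall x, unit_ball R p x -> s (ga x)) ->
    unit_sphere R p w -> W (ga (t *: w)) <-> W (ga w).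
  move=> gaW gas Sw; have Dw := sphere_sub_ball Sw.
  have Dtw := scale_sphere_ball Sw t01.
  split=> Ww.
    apply: ((gaW w Dw).2 _).2 => j jk.
    have := (gaW _ Dtw).1 (conj (gas _ Dtw) Ww) j jk.
    by rewrite mxE => /eqP; rewrite mulf_eq0 gt_eqF //= => /eqP.
  apply: ((gaW _ Dtw).2 _).2 => j jk.
  by rewrite mxE ((gaW w Dw).1 (conj (gas _ Dw) Ww) j jk) mulr0.
rewrite ztu Ctu.
apply: (iff_trans (scaleY n setT X (c i) Y al u alY (homeo_image hal) Su)).
apply: (iff_trans _ (iff_sym (scaleY m setT X' (c' i) Y' be v beY (homeo_image hbe) Sv))).
by rewrite -Phiu; apply: YPhi; rewrite (relbdE hal); exists u.
Qed.

Let support (A : {set I}) : set X := \bigcup_(i in [set` A]) c i.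
Let support' (A : {set I}) : set X' := \bigcup_(i in [set` A]) c' i.

(** Induction on the number of cells outside [A], adding one of minimal rank at each turn. *)
Lemma extend_subcomplex (A : {set I}) (Phi : X -> X') :
  (forall a b, a \in A -> c b `<=` c a -> b \in A) ->
  homeo_on (support A) (support' A) Phi ->
  (forall i, i \in A -> Phi @` c i = c' i) ->
  (forall x, support A x -> (Y x <-> Y' (Phi x))) ->
  exists Psi : X -> X', [/\ homeo_on (support [set: I]%SET) (support' [set: I]%SET) Psi,
    (forall i, Psi @` c i = c' i) & forall x, support [set: I]%SET x -> (Y x <-> Y' (Psi x))].
Proof.
have [r] := ubnP #|~: A|; elim: r A Phi => // r IH A Phi Ar Adown hPhi cPhi YPhi.
have [AT|AT] := eqVneq A [set: I]%SET.
  by rewrite -AT; exists Phi; split=> // i; apply: cPhi; rewrite AT inE.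
have [i0 i0A] : exists i, i \notin A.
  by apply/existsP; rewrite -negb_forall; apply: contra_neqN AT => /forallP H; apply/setP => i; rewrite H inE.
(* By minimality all proper faces of [c i] are in [A], so its relative boundary is exactly its
   overlap with [support A]. *)
pose i := [arg min_(i < i0 | i \notin A) cell_rank c i].
have [iA imin] : i \notin A /\ forall j, j \notin A -> (cell_rank c i <= cell_rank c j)%N.
  by rewrite /i; case: arg_minnP.
have below j : c j `<=` c i -> j != i -> j \in A.
  move=> ji nji; apply: contraT => /imin.
  by rewrite leqNgt (cell_rank_lt cCW).
have A'down a b : a \in A -> c' b `<=` c' a -> b \in A by move=> aA /c_mono; exact: Adown.
have bdE : relbd R (c i) = support A `&` c i.
  apply/seteqP; split=> x.
    move=> bx; split; last exact: (relbd_sub_cell cCW).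
    have [l [lx li lsub]] := relbd_proper_cell cCW bx.
    by exists l => //; exact: below.
  by move=> [[j jA jx] ix]; exact: (cell_meet_relbd cCW Adown iA jA jx ix).
have bd'E : relbd R (c' i) = support' A `&` c' i.
  apply/seteqP; split=> x.
    move=> bx; split; last exact: (relbd_sub_cell c'CW).
    have [l [lx li /c_mono lsub]] := relbd_proper_cell c'CW bx.
    by exists l => //; exact: below.
  by move=> [[j jA jx] ix]; exact: (cell_meet_relbd c'CW A'down iA jA jx ix).
(* [Phi] matches the cells of [A], and the two complexes have the same inclusions, so boundary faces
   go to boundary faces. *)
have bdPhi : Phi @` relbd R (c i) = relbd R (c' i).
  apply/seteqP; split=> [_ [x bx <-]|y bx].
    have [l [lx li lsub]] := relbd_proper_cell cCW bx.
    apply: (sub_relbd c'CW ((c_mono l i).1 lsub) li).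
    by rewrite -cPhi; [exists x | exact: below].
  have [l [lx li /c_mono lsub]] := relbd_proper_cell c'CW bx.
  move: lx; rewrite -cPhi; last exact: below.
  by move=> [x lx <-]; exists x => //; exact: (sub_relbd cCW lsub li).
have hbd : homeo_on (relbd R (c i)) (relbd R (c' i)) Phi.
  by rewrite -bdPhi; apply: homeo_restrict hPhi; rewrite bdE => x [].
have [|C [hC CPhi YC]] := extend_to_cell hbd.
  by move=> x; rewrite bdE => -[Ax _]; exact: YPhi.
have cA : closed (support A).
  by apply: closed_bigcup => // j _; exact: (closed_cell hX cCW).
have cA' : closed (support' A).
  by apply: closed_bigcup => // j _; exact: (closed_cell hX' c'CW).
have [||Psi [hPsi PsiPhi PsiC]] := homeo_glue cA (closed_cell hX cCW (i := i)) cA'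
    (closed_cell hX' c'CW (i := i)) hPhi hC.
- by move=> x Ax ix; rewrite CPhi // bdE.
- by rewrite -bd'E -bdE bdPhi.
have supE (T : Type) (d : I -> set T) :
    \bigcup_(j in [set` i |: A]%SET) d j = \bigcup_(j in [set` A]) d j `|` d i.
  apply/seteqP; split=> [x [j /=]|x [[j jA jx]|ix]].
  - by rewrite in_setU1 => /orP[/eqP->|jA] jx; [right|left; exists j].
  - by exists j => //=; rewrite in_setU1 jA orbT.
  - by exists i => //=; rewrite in_setU1 eqxx.
apply: (IH (i |: A)%SET Psi).
- rewrite -ltnS; apply: leq_trans Ar; rewrite ltnS; apply/proper_card/properP; split.
    by apply/fintype.subsetP => j; rewrite !inE negb_or => /andP[].
  by exists i; rewrite !inE ?eqxx.
- move=> a b; rewrite !in_setU1 => /orP[/eqP->|aA] ba; last by rewrite (Adown a) ?orbT.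
  by have [//|bi] := eqVneq b i; rewrite below.
- by rewrite /support /support' !supE.
- move=> j; rewrite in_setU1 => /orP[/eqP->|jA].
    have [g [_ _ <- _ _]] := hC.
    by apply/seteqP; split=> _ [x ix <-]; exists x => //; rewrite PsiC.
  rewrite -cPhi //.
  by apply/seteqP; split=> _ [x ix <-]; exists x => //; rewrite PsiPhi //; exists j.
- move=> x; rewrite /support supE => -[Ax|ix]; first by rewrite PsiPhi //; exact: YPhi.
  by rewrite PsiC //; exact: YC.
Qed.

End Extension.

(** Lets both complexes share one index type, so that the poset isomorphism becomes the identity on
    indices. *)
Lemma regular_CW_reindex (R : realType) (X : topologicalType) (I I' : finType)
    (c : I' -> set X) (phi : I -> I') :
  bijective phi -> regular_CW R c -> regular_CW R (c \o phi).
Proof.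
move=> [psi phiK psiK] [cinj cpart cbd]; split.
- exact: inj_comp cinj (can_inj phiK).
- move=> x; have [i [ix iu]] := cpart x; exists (psi i); split; first by rewrite /= psiK.
  by move=> j jx; rewrite (iu _ jx) phiK.
- move=> i; have [n [cn [J [bdE Jm]]]] := cbd (phi i).
  exists n; split=> //; exists (phi @^-1` J); split=> [|j]; last exact: Jm.
  rewrite bdE; apply/seteqP; split=> [x [j Jj jx]|x [j Jj jx]]; last by exists (phi j).
  by exists (psi j); rewrite /= psiK.
Qed.

Theorem mainTheorem13 (R : realType) (X X' : topologicalType)
  (hX : hausdorff_space X) (hX' : hausdorff_space X')
  (I I' : finType) (c : I -> set X) (c' : I' -> set X') (k : nat)
  (Y : set X) (Y' : set X')
  (pXY : regular_CW_pair R c k Y) (pXY' : regular_CW_pair R c' k Y')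
  (phi : I -> I') (phi_bij : bijective phi)
  (phi_mono : forall i j, c i `<=` c j <-> c' (phi i) `<=` c' (phi j))
  (phi_Y : phi @` cells_meeting c Y = cells_meeting c' Y') :
  exists Phi : X -> X',
    [/\ homeo_on setT setT Phi,
        (forall i, Phi @` c i = c' (phi i)) &
        Phi @` Y = Y'].
Proof.
have [psi phiK psiK] := phi_bij.
have pXY'' : regular_CW_pair R (c' \o phi) k Y'.
  by split=> [|i]; [exact: regular_CW_reindex pXY'.1 | exact: pXY'.2].
have meetE i : c i `&` Y !=set0 <-> (c' \o phi) i `&` Y' !=set0.
  split=> [iY|iY].
    have : cells_meeting c' Y' (phi i) by rewrite -phi_Y; exists i.
    by [].
  have : cells_meeting c' Y' (phi i) by [].
  by rewrite -phi_Y => -[j jY /(can_inj phiK) <-].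
have empty (Z : topologicalType) (d : I -> set Z) : \bigcup_(i in [set` (finset.set0 : {set I})]) d i = set0.
  by apply/seteqP; split=> // x [i]; rewrite /= inE.
have full (Z : topologicalType) (d : I -> set Z) : (regular_CW R d) ->
    \bigcup_(i in [set` [set: I]%SET]) d i = setT.
  move=> [_ part _]; apply/seteqP; split=> // x _.
  by have [i [[ix _] _]] := part x; exists i => //=; rewrite inE.
(* The induction starts from the empty subcomplex with an arbitrary map. One exists even if the
   spaces may be empty: a point of the source yields a cell index, and the target cell with that
   index has a centre. *)
have point (T U : topologicalType) (d : I -> set T) (e : I -> set U) :
    regular_CW R d -> regular_CW R e -> exists f : T -> U, True.
  move=> [_ part _] eCW.
  have /choice[f _] : forall x : T, exists y : U, True; last by exists f.
  by move=> x; have [i _] := part x; have [n [al _]] := cell_chart eCW i; exists (al 0).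
have [f _] := point _ _ _ _ pXY.1 pXY''.1.
have [g _] := point _ _ _ _ pXY''.1 pXY.1.
have [||||Phi [hPhi cPhi YPhi]] := extend_subcomplex hX hX' pXY pXY'' phi_mono meetE
    (A := finset.set0) (Phi := f).
- by move=> a b; rewrite inE.
- rewrite !empty; exists g; split=> //; [exact/withinP|exact/withinP|exact: image_set0].
- by move=> i; rewrite inE.
- by move=> x; rewrite empty.
rewrite full in hPhi YPhi; last exact: pXY.1.
rewrite full in hPhi; last exact: pXY''.1.
exists Phi; split=> //; apply/seteqP; split=> [_ [x Yx <-]|y Yy]; first exact/YPhi.
have [h [_ _ PhiT _ _]] := hPhi.
have [x _ xy] : (Phi @` setT) y by rewrite PhiT.
by exists x => //; apply/YPhi => //; rewrite xy.
Qed.
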